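(* Magnitude, $A\mapsto |A|$, is continuous with respect to the Gromov--Hausdorff distance on the class of positively weighted compact positive definite metric spaces.
   Context: Metric spaces are nonempty. For a finite metric space $(B,d)$, its similarity matrix is $\zeta_B \in \mathbb{R}^{B\times B}$, $\zeta_B(x,y)=e^{-d(x,y)}$; a metric space $A$ is positive definite if $\zeta_B$ is a positive definite matrix for every nonempty finite subset $B \subseteq A$ (with the induced metric). $M(A)$ is the space of finite signed Borel measures on $A$ and $M_+(A)$ the cone of positive (nonnegative) measures in $M(A)$. For compact $(A,d)$, $Z_A(\mu,\nu) = \int_A\int_A e^{-d(x,y)}\,d\mu(x)\,d\nu(y)$. For a compact positive definite metric space $A$, the magnitude is $|A| = \sup\{\mu(A)^2/Z_A(\mu,\mu) : \mu\in M(A),\ Z_A(\mu,\mu)\neq 0\}$ and the maximum diversity is $|A|_+ = \sup\{\mu(A)^2/Z_A(\mu,\mu) : \mu\in M_+(A),\ \mu\neq 0\}$; $A$ is called positively weighted if $|A|=|A|_+$. The Gromov--Hausdorff distance is $d_{GH}(A,B) = \inf d_H(\varphi(A),\psi(B))$, the infimum over all metric spaces $X$ and isometric embeddings $\varphi:A\to X$, $\psi:B\to X$, where $d_H(S,T) = \max\{\sup_{s\in S} d(s,T),\ \sup_{t\in T} d(t,S)\}$ is the Hausdorff distance in $X$. *)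

(* Defs.v *)
From HB Require Import structures.
From mathcomp Require Import all_boot all_order all_algebra finmap.
From mathcomp Require Import all_classical all_reals all_analysis.

Set Implicit Arguments.
Unset Strict Implicit.
Unset Printing Implicit Defensive.

Import Order.TTheory GRing.Theory Num.Theory.
Import numFieldNormedType.Exports.

Local Open Scope classical_set_scope.
Local Open Scope ring_scope.

(* Metric spaces are nonempty. Nonemptiness is carried as a chosen point, since
   the library's measurable types are pointed; the point plays no other role. *)
#[short(type="pmetricType")]
HB.structure Definition PointedMetric (R : numDomainType) :=
  {M of Pointed M & Metric R M}.

Section positive_definite.
Context {R : realType}.

Definition posdefmx (n : nat) (M : 'M[R]_n) : Prop :=
  M^T = M /\ forall v : 'cV[R]_n, v != 0 -> 0 < (v^T *m M *m v) 0 0.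

(* Rows and columns are indexed by B through its enumeration [enum_val]. *)
Definition similarity_matrix (A : metricType R) (B : {fset A}) : 'M[R]_#|{: B}| :=
  \matrix_(i, j) expR (- mdist (val (enum_val i)) (val (enum_val j))).

Definition positive_definite_space (A : metricType R) : Prop :=
  forall B : {fset A}, B != fset0 -> posdefmx (similarity_matrix B).

End positive_definite.

Section charge_integral.
Context d (T : measurableType d) (R : realType).

(* Integral against a finite signed measure, through its Jordan decomposition;
   the latter does not depend on the Hahn decomposition that is picked
   ([Hahn_decomposition_uniq]). Intended for nu-integrable f. *)
Definition charge_integral (nu : {charge set T -> \bar R}) (f : T -> R) : R :=
  let: exist _ PnuPN := cid (Hahn_decomposition nu) in
  let: exist _ nuPN := cid PnuPN in
  Rintegral (jordan_pos nuPN) setT f - Rintegral (jordan_neg nuPN) setT f.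

End charge_integral.

Section magnitude.
Context {R : realType} (A : pmetricType R).

Definition borel := g_sigma_algebraType (@open A).

Definition signed_measure := {charge set borel -> \bar R}.

(* Values of a charge outside the sigma-algebra are unspecified, hence the
   restriction to measurable sets in the next two definitions. *)
Definition positive_measure (mu : signed_measure) : Prop :=
  forall S : set borel, measurable S -> (0 <= mu S)%E.

Definition nonzero_measure (mu : signed_measure) : Prop :=
  exists2 S : set borel, measurable S & mu S != 0%E.

Definition Zform (mu nu : signed_measure) : R :=
  charge_integral nu (fun y : A =>
    charge_integral mu (fun x : A => expR (- mdist x y))).

Definition quotient_of (mu : signed_measure) : \bar R :=
  (fine (mu setT) ^+ 2 / Zform mu mu)%:E.

Definition magnitude : \bar R :=
  ereal_sup [set quotient_of mu | mu in [set mu | Zform mu mu != 0]].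

Definition max_diversity : \bar R :=
  ereal_sup [set quotient_of mu |
             mu in [set mu | positive_measure mu /\ nonzero_measure mu]].

Definition positively_weighted : Prop := magnitude = max_diversity.

(* The class of positively weighted compact positive definite metric spaces. *)
Definition pwcpd_space : Prop :=
  [/\ compact [set: A], positive_definite_space A & positively_weighted].

End magnitude.

Section gromov_hausdorff.
Context {R : realType}.

Definition point_set_dist (X : metricType R) (s : X) (T : set X) : \bar R :=
  ereal_inf [set (mdist s t)%:E | t in T].

Definition hausdorff_dist (X : metricType R) (S T : set X) : \bar R :=
  Order.max (ereal_sup [set point_set_dist s T | s in S])
            (ereal_sup [set point_set_dist t S | t in T]).

Definition isometric_embedding (A X : metricType R) (phi : A -> X) : Prop :=
  forall x y, mdist (phi x) (phi y) = mdist x y.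

Definition gh_dist (A B : metricType R) : \bar R :=
  ereal_inf [set r | exists (X : metricType R) (phi : A -> X) (psi : B -> X),
    [/\ isometric_embedding phi, isometric_embedding psi &
        r = hausdorff_dist (range phi) (range psi)]].

End gromov_hausdorff.

(* Main.v *)
Require Import Defs.
From HB Require Import structures.
From mathcomp Require Import all_boot all_order all_algebra finmap.
From mathcomp Require Import all_classical all_reals all_analysis.
From mathcomp Require Import measurable_realfun ring lra.

(** On the spaces considered here magnitude is maximum diversity, so it is
    enough to show that maximum diversity varies little under a small
    Gromov--Hausdorff perturbation.  The mechanism is that the diversity of a
    positive measure, [mu(A)^2 / Z(mu, mu)], behaves well under transport:
    if [f : A -> B] is Borel and changes distances by at most [eta], then the
    kernel [e^(- d)] changes by a factor between [e^(- eta)] and [e^eta], hence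
    so does the double integral [Z] when [mu] is replaced with its image under
    [f], while the total mass is unchanged.  Taking suprema,
    [|A|_+ <= e^eta |B|_+] ([max_diversity_le]).

    When [d_GH(A, B) < delta], sending each point of [A] to a point of [B] that
    is [delta]-close in a common ambient space changes distances by at most
    [2 delta] ([gh_dist_almost_isometry]).  Such a map is arbitrary, so it
    cannot transport measures; but by compactness the points of [A] may first
    be rounded, in a Borel way, to finitely many centres, which costs another
    [2 delta] ([measurable_almost_isometry]).  Exchanging [A] and [B], the two
    maximum diversities agree up to a factor [e^(4 delta)]
    ([max_diversity_le_gh]), and multiplication by a factor near 1 is continuous
    at every point of the extended line ([nbhs_ereal_expR]). *)

Set Implicit Arguments.
Unset Strict Implicit.
Unset Printing Implicit Defensive.

Import Order.TTheory GRing.Theory Num.Theory.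
Import numFieldNormedType.Exports.

Local Open Scope classical_set_scope.
Local Open Scope ring_scope.

(** * Integrals against positive charges and finite measures *)

(** The negative part of the Jordan decomposition of a positive charge vanishes,
    so its positive part is a finite measure that represents the charge; this
    reduces signed integration to the ordinary Lebesgue integral. *)
Lemma positive_charge_integral d (T : measurableType d) (R : realType)
    (nu : {charge set T -> \bar R}) :
  (forall S, measurable S -> (0 <= nu S)%E) ->
  exists m : {finite_measure set T -> \bar R},
    (forall S, measurable S -> m S = nu S) /\
    (forall f, charge_integral nu f = Rintegral m setT f).
Proof.
move=> nu0; rewrite /charge_integral.
case: (cid _) => P Pdec; case: (cid _) => N PN.
have [[mP _] [mN Nneg] PNT PN0] := PN.
have nuN S : measurable S -> nu (S `&` N) = 0%E.
  move=> mS; have mSN : measurable (S `&` N) by exact: measurableI.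
  by apply/eqP; rewrite eq_le nu0// andbT; apply: Nneg.
have negE S : measurable S -> jordan_neg PN S = 0%E.
  move=> mS; rewrite jordan_negE cjordan_negE /crestr0 mem_set// /crestr.
  by rewrite nuN// oppe0.
exists (jordan_pos PN); split => [S mS|f].
  rewrite (jordan_decomp PN mS) /cadd /= cscaleN1.
  by have /= -> := negE _ mS; rewrite oppe0 adde0.
rewrite [X in _ - X](_ : _ = 0) ?subr0// /Rintegral.
rewrite (@eq_measure_integral _ _ _ _ mzero) ?integral_measure_zero//.
by move=> S mS _; exact: negE.
Qed.

Section finite_measure_integral.
Context d (T : measurableType d) (R : realType).
Variable m : {finite_measure set T -> \bar R}.

Lemma bounded_integrable (f : T -> R) (M : R) :
  measurable_fun setT f -> (forall x, 0 <= f x <= M) ->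
  m.-integrable setT (EFin \o f).
Proof.
move=> mf fM; apply: measurable_bounded_integrable => //.
  exact: fin_num_fun_lty.
exists M; split; rewrite ?num_real// => x Mx y _ /=.
have /andP[f0 fy] := fM y.
by rewrite ger0_norm// (le_trans fy)// ltW.
Qed.

Lemma le_RintegralZ (f g : T -> R) (c M N : R) :
  measurable_fun setT f -> (forall x, 0 <= f x <= M) ->
  measurable_fun setT g -> (forall x, 0 <= g x <= N) ->
  (forall x, f x <= c * g x) ->
  Rintegral m setT f <= c * Rintegral m setT g.
Proof.
move=> mf fM mg gN fg.
have ig := bounded_integrable mg gN.
rewrite -RintegralZl//; apply: le_Rintegral => //.
  exact: bounded_integrable fM.
by have := integrableZl measurableT c ig; apply: eq_integrable.
Qed.

(** Change of variables, for any measure [n] that agrees with the image of [m]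
    on measurable sets, since the finite measure that represents an image
    charge is determined only there. *)
Lemma Rintegral_image d' (T' : measurableType d')
    (n : {measure set T' -> \bar R}) (f : T -> T') (g : T' -> R) :
  measurable_fun setT f ->
  (forall S, measurable S -> n S = m (f @^-1` S)) ->
  measurable_fun setT g -> (forall y, 0 <= g y) ->
  Rintegral n setT g = Rintegral m setT (g \o f).
Proof.
move=> mf nE mg g0; rewrite /Rintegral; congr fine.
rewrite (@eq_measure_integral _ _ _ _ (pushforward m f)); last first.
  by move=> S mS _; exact: nE.
rewrite ge0_integral_pushforward ?preimage_setT//.
- exact/measurable_EFinP.
- by move=> y _; rewrite lee_fin.
Qed.

End finite_measure_integral.

(** * Potentials and energies of Borel measures on metric spaces *)

Section potential_energy.
Context (R : realType) (A : pmetricType R).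

Lemma open_borel (U : set (borel A)) : @open A U -> measurable U.
Proof. by move=> oU; exact: sub_sigma_algebra. Qed.

(** Where [f] is positive, the second hypothesis says that [ln f] is 1-Lipschitz;
    in general it makes every superlevel set of [f] open.  The kernel
    [e^(- d(_, y))] satisfies it by the triangle inequality, and it survives
    integration over [y], so it also applies to potentials. *)
Lemma log_lipschitz_measurable (f : borel A -> R) :
  (forall x, 0 <= f x) ->
  (forall x y : A, expR (- mdist x y) * f x <= f y) ->
  measurable_fun setT f.
Proof.
move=> f0 fL; apply: (measurability _ (RGenOInfty.measurableE R)) =>
  /= _ [_ [c ->] <-].
rewrite setTI; apply: open_borel; rewrite openE => x /=.
rewrite in_itv/= andbT => cfx; rewrite /interior.
(* If [t] is less than this radius then [t * f x < f x - c], and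
   [1 - t <= expR (- t)]; the [+ 1] covers the case [f x = 0]. *)
apply/nbhs_ballP; exists ((f x - c) / (f x + 1)) => /=.
  by rewrite divr_gt0 ?subr_gt0// ltr_wpDl.
have fx1 : 0 < f x + 1 by rewrite ltr_wpDl.
move=> y; rewrite ballEmdist /= in_itv/= andbT ltr_pdivlMr// => xy.
apply: lt_le_trans (fL x y).
have d0 := mdist_ge0 x y.
have := expR_ge1Dx (- mdist x y).
have := f0 x.
nra.
Qed.

Lemma measurable_similarity_to (y : A) :
  measurable_fun setT (fun x : borel A => expR (- mdist (x : A) y)).
Proof.
apply: log_lipschitz_measurable => [x|x z]; first exact: expR_ge0.
rewrite -expRD ler_expR.
have := metric_triangle z x y; rewrite (metric_sym z x); lra.
Qed.

Lemma expRN_mdist_bounds (x y : A) : 0 <= expR (- mdist x y) <= 1.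
Proof. by rewrite expR_ge0 -expR0 ler_expR oppr_le0 mdist_ge0. Qed.

Variable m : {finite_measure set (borel A) -> \bar R}.

Definition potential (y : A) : R :=
  Rintegral m setT (fun x : borel A => expR (- mdist (x : A) y)).

Lemma potential_bounds y : 0 <= potential y <= Rintegral m setT (cst 1).
Proof.
apply/andP; split; first by apply: Rintegral_ge0 => x _; exact: expR_ge0.
rewrite -[leRHS]mul1r; apply: (@le_RintegralZ _ _ _ _ _ _ _ 1 1) => //.
- exact: measurable_similarity_to.
- by move=> x; exact: expRN_mdist_bounds.
- by move=> x; rewrite /= ler01 lexx.
- by move=> x; rewrite mul1r; case/andP: (expRN_mdist_bounds x y).
Qed.

Lemma measurable_potential : measurable_fun setT (potential : borel A -> R).
Proof.
apply: log_lipschitz_measurable => [y|y z].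
  by case/andP: (potential_bounds y).
rewrite -ler_pdivlMl ?expR_gt0// -expRN opprK.
apply: (@le_RintegralZ _ _ _ _ _ _ _ 1 1).
- exact: measurable_similarity_to.
- by move=> x; exact: expRN_mdist_bounds.
- exact: measurable_similarity_to.
- by move=> x; exact: expRN_mdist_bounds.
move=> x; rewrite -expRD ler_expR.
have := metric_triangle x y z; lra.
Qed.

Definition energy : R := Rintegral m setT (potential : borel A -> R).

Lemma energy_ge0 : 0 <= energy.
Proof.
by apply: Rintegral_ge0 => y _; case/andP: (potential_bounds y).
Qed.

End potential_energy.

Lemma Zform_energy (R : realType) (A : pmetricType R) (mu : signed_measure A) :
  positive_measure mu ->
  exists m : {finite_measure set (borel A) -> \bar R},
    (forall S, measurable S -> m S = mu S) /\ Zform mu mu = energy m.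
Proof.
move=> /positive_charge_integral[m [mE intE]]; exists m; split => //.
rewrite /Zform intE; apply: eq_Rintegral => y _.
by rewrite intE.
Qed.

(** * Transport along almost isometries *)

Definition almost_isometry (R : realType) (A B : metricType R) (eta : R)
    (g : A -> B) :=
  forall x y, `|mdist (g x) (g y) - mdist x y| <= eta.

Section energy_transport.
Context (R : realType) (A B : pmetricType R).
Variables (eta : R) (f : borel A -> borel B).
Hypothesis mf : measurable_fun setT f.
Hypothesis f_eta : @almost_isometry R A B eta f.

Variables (m : {finite_measure set (borel A) -> \bar R})
  (n : {finite_measure set (borel B) -> \bar R}).
Hypothesis nE : forall S, measurable S -> n S = m (f @^-1` S).

Lemma potential_image (y : B) :
  potential n y = Rintegral m setT (fun x => expR (- mdist (f x : B) y)).
Proof.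
rewrite /potential (Rintegral_image mf nE)//.
  exact: measurable_similarity_to.
Qed.

Let mf_similarity (y : B) :
  measurable_fun setT (fun x => expR (- mdist (f x : B) y)).
Proof. exact: (measurableT_comp (measurable_similarity_to y) mf). Qed.

Lemma energy_image : energy n = Rintegral m setT (potential n \o f).
Proof.
rewrite /energy (Rintegral_image mf nE)//; first exact: measurable_potential.
by move=> y; case/andP: (potential_bounds n y).
Qed.

Let image_potential_bounds (y : A) :
  0 <= (potential n \o f) y <= Rintegral n setT (cst 1).
Proof. exact: potential_bounds. Qed.

Lemma energy_image_le : energy n <= expR eta * energy m.
Proof.
rewrite energy_image.
apply: (@le_RintegralZ _ _ _ m (potential n \o f) (potential m) _ _ _ _
  image_potential_bounds _ (potential_bounds m)).
- exact: (measurableT_comp (measurable_potential n) mf).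
- exact: measurable_potential.
move=> y; rewrite /= potential_image; apply: (@le_RintegralZ _ _ _ _ _ _ _ 1 1).
- exact: mf_similarity.
- by move=> x; exact: expRN_mdist_bounds.
- exact: measurable_similarity_to.
- by move=> x; exact: expRN_mdist_bounds.
move=> x; rewrite -expRD ler_expR.
have := f_eta x y; rewrite ler_norml; lra.
Qed.

Lemma energy_le_image : energy m <= expR eta * energy n.
Proof.
rewrite energy_image.
apply: (@le_RintegralZ _ _ _ m (potential m) (potential n \o f) _ _ _ _
  (potential_bounds m) _ image_potential_bounds).
- exact: measurable_potential.
- exact: (measurableT_comp (measurable_potential n) mf).
move=> y; rewrite /= potential_image; apply: (@le_RintegralZ _ _ _ _ _ _ _ 1 1).
- exact: measurable_similarity_to.
- by move=> x; exact: expRN_mdist_bounds.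
- exact: mf_similarity.
- by move=> x; exact: expRN_mdist_bounds.
move=> x; rewrite -expRD ler_expR.
have := f_eta x y; rewrite ler_norml; lra.
Qed.

End energy_transport.

Lemma signed_measure_image (R : realType) (A B : pmetricType R)
    (mu : signed_measure A) (f : borel A -> borel B) :
  measurable_fun setT f ->
  exists nu : signed_measure B, forall S, nu S = mu (f @^-1` S).
Proof.
move=> mf.
by unshelve eexists (pushforward mu f : signed_measure B).
Qed.

(** Both energy comparisons are used: one makes the energy of the image positive
    when that of [mu] is, the other bounds the quotient.  If the energy of [mu]
    is 0, then so is its quotient by the convention [0^-1 = 0]. *)
Lemma max_diversity_le (R : realType) (A B : pmetricType R) (eta : R)
    (f : borel A -> borel B) :
  measurable_fun setT f ->
  @almost_isometry R A B eta f ->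
  (max_diversity A <= (expR eta)%:E * max_diversity B)%E.
Proof.
move=> mf f_eta; apply: ge_ereal_sup => _ [mu [mu0 [S mS muS]] <-].
have [nu nuE] := signed_measure_image mu mf.
have mpre T : measurable T -> measurable (f @^-1` T).
  by move=> mT; rewrite -[X in measurable X]setTI; exact: mf.
have nu0 : positive_measure nu.
  by move=> T mT; rewrite nuE; apply: mu0; exact: mpre.
have nunz : nonzero_measure nu.
  exists setT => //; rewrite nuE preimage_setT gt_eqF//.
  have : (0 < mu S)%E by rewrite lt_def muS mu0.
  move=> /lt_le_trans; apply.
  have mCS : measurable (~` S) by exact: measurableC.
  rewrite -(setUv S) chargeU ?setICr// leeDl//; exact: mu0.
have [m [mE ZmuE]] := Zform_energy mu0.
have [n [nE ZnuE]] := Zform_energy nu0.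
have nmE T : measurable T -> n T = m (f @^-1` T).
  by move=> mT; rewrite nE// mE ?nuE//; exact: mpre.
have nu_le : (quotient_of nu <= max_diversity B)%E.
  by apply: ereal_sup_ubound; exists nu.
apply: (@le_trans _ _ ((expR eta)%:E * quotient_of nu)%E); last first.
  by rewrite lee_pmul2l// lte_fin expR_gt0.
rewrite /quotient_of ZmuE ZnuE nuE preimage_setT -EFinM lee_fin.
have e0 := expR_gt0 eta.
have := energy_ge0 m; rewrite le_eqVlt => /predU1P[<-|m0].
  rewrite invr0 mulr0 mulr_ge0 ?(ltW e0)// divr_ge0 ?sqr_ge0//.
  exact: energy_ge0.
have n_le := energy_image_le mf f_eta nmE.
have n0 : 0 < energy n.
  have := lt_le_trans m0 (energy_le_image mf f_eta nmE).
  by rewrite pmulr_rgt0.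
rewrite mulrCA ler_wpM2l ?sqr_ge0//.
by rewrite ler_pdivlMr// mulrC ler_pdivrMr.
Qed.

(** * Gromov--Hausdorff closeness yields Borel almost isometries *)

Lemma gh_dist_almost_isometry (R : realType) (A B : metricType R) (delta : R) :
  (gh_dist A B < delta%:E)%E ->
  (exists g : A -> B, almost_isometry (2 * delta) g) /\
  (exists h : B -> A, almost_isometry (2 * delta) h).
Proof.
move=> /ereal_inf_lt[_ [X [phi [psi [phiE psiE ->]]]]].
rewrite /hausdorff_dist gt_max => /andP[AB BA].
have near_map (C D : metricType R) (c : C -> X) (d : D -> X) :
    isometric_embedding c -> isometric_embedding d ->
    (ereal_sup [set point_set_dist s (range d) | s in range c] < delta%:E)%E ->
    exists g : C -> D, almost_isometry (2 * delta) g.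
  move=> cE dE CD.
  have /choice[g gP] : forall x, exists y, mdist (c x) (d y) < delta.
    move=> x.
    have : (point_set_dist (c x) (range d) < delta%:E)%E.
      apply: le_lt_trans CD; apply: ereal_sup_ubound.
      by exists (c x) => //; exists x.
    by move=> /ereal_inf_lt[_ [_ [y _ <-] <-]]; rewrite lte_fin; exists y.
  exists g => x y; rewrite -cE -dE ler_norml.
  have gx := gP x; have gy := gP y.
  (* Both estimates go round the quadrilateral with vertices [c x], [c y],
     [d (g x)] and [d (g y)]. *)
  have := metric_triangle (c x) (d (g x)) (c y).
  have := metric_triangle (d (g x)) (d (g y)) (c y).
  have := metric_triangle (d (g x)) (c x) (d (g y)).
  have := metric_triangle (c x) (c y) (d (g y)).
  rewrite (metric_sym (d (g x)) (c x)) (metric_sym (d (g y)) (c y)).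
  lra.
by split; [exact: near_map AB|exact: near_map BA].
Qed.

(** [f x] is the image under [g] of the first centre close to [x], in a finite
    list of centres given by compactness.  Close means interior to the ball of
    radius [eps], so that each test in the search is an open condition and [f]
    is Borel whatever [g] is. *)
Lemma measurable_almost_isometry (R : realType) (A B : pmetricType R)
    (eta eps : R) (g : A -> B) :
  compact [set: A] -> 0 < eps ->
  almost_isometry eta g ->
  exists f : borel A -> borel B, measurable_fun setT f /\
    @almost_isometry R A B (eta + 2 * eps) f.
Proof.
move=> cA eps0 g_eta.
pose near_set (a : A) : set A := interior (ball a eps).
have nearP a x : near_set a x -> mdist a x < eps.
  by move=> /interior_subset; rewrite ballEmdist.
have [s sP] : exists s : seq A, forall x, exists2 a, a \in s & near_set a x.
  move: cA; rewrite compact_cover => /(_ A setT near_set)[].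
  - by move=> a _; exact: open_interior.
  - move=> x _; exists x => //; rewrite /near_set /interior.
    exact: nbhsx_ballx.
  move=> D _ cD; exists (enum_fset D) => x.
  by have [a aD ax] := cD x I; exists a.
pose first_near (t : seq A) (x : A) : A :=
  foldr (fun a b => if `[< near_set a x >] then a else b) point t.
have first_nearP t x : (exists2 a, a \in t & near_set a x) ->
    mdist (first_near t x) x < eps.
  elim: t => [[]//|a t IH] [b]; rewrite inE => bt bx /=.
  case: asboolP => [|ax]; first exact: nearP.
  apply: IH; exists b => //; move: bt => /predU1P[ba|//].
  by rewrite ba in bx.
exists (g \o first_near s); split; last first.
  move=> x y /=; rewrite ler_norml.
  have := g_eta (first_near s x) (first_near s y); rewrite ler_norml.
  have nx := first_nearP _ _ (sP x); have ny := first_nearP _ _ (sP y).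
  move: nx ny; set p := first_near s x; set q := first_near s y => nx ny.
  have := metric_triangle p x q; have := metric_triangle x y q.
  have := metric_triangle x p y; have := metric_triangle p q y.
  rewrite (metric_sym x p) (metric_sym y q).
  lra.
elim: (s) => [|a t IH] /=.
  exact: (@measurable_cst _ _ (borel A) (borel B) setT (g point)).
rewrite [X in measurable_fun _ X](_ : _ = fun x : borel A =>
    if `[< near_set a x >] then g a : borel B else g (first_near t x));
  last by apply/funext => x /=; case: ifP.
apply: measurable_fun_ifT => //.
apply: (measurable_fun_bool true).
rewrite setTI (_ : _ @^-1` _ = near_set a).
  by apply: open_borel; exact: open_interior.
by apply/seteqP; split=> x /= /asboolP.
Qed.

(** * Continuity *)

Lemma max_diversity_le_gh (R : realType) (A B : pmetricType R) (delta : R) :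
  compact [set: A] -> compact [set: B] -> 0 < delta ->
  (gh_dist A B < delta%:E)%E ->
  (max_diversity A <= (expR (4 * delta))%:E * max_diversity B)%E /\
  (max_diversity B <= (expR (4 * delta))%:E * max_diversity A)%E.
Proof.
move=> cA cB d0 /gh_dist_almost_isometry[[g gd] [h hd]].
have [f [mf fd]] := measurable_almost_isometry cA d0 gd.
have [k [mk kd]] := measurable_almost_isometry cB d0 hd.
have -> : 4 * delta = 2 * delta + 2 * delta by ring.
by split; [exact: max_diversity_le fd|exact: max_diversity_le kd].
Qed.

(** At a finite [a] the bounds squeeze [b] between [e^(- eta) a] and [e^eta a];
    at an infinite [a] they force [b = a]. *)
Lemma nbhs_ereal_expR (R : realType) (a : \bar R) (V : set (\bar R)) :
  nbhs a V ->
  exists2 eta : R, 0 < eta &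
    forall b : \bar R, (a <= (expR eta)%:E * b)%E ->
      (b <= (expR eta)%:E * a)%E -> V b.
Proof.
move=> aV.
case: a aV => [a| |] aV; last 2 first.
- exists 1 => // b + _; case: b => [b| |].
  + by rewrite leye_eq.
  + by move=> _; exact: nbhs_singleton.
  + by rewrite gt0_muleNy ?lte_fin ?expR_gt0.
- exists 1 => // b _; rewrite gt0_muleNy ?lte_fin ?expR_gt0// leeNy_eq.
  by move=> /eqP ->; exact: nbhs_singleton.
have cont (s : R) : (expR (s * t) * a)%R @[t --> (0 : R)] --> a.
  have : (expR (s * t) * a)%R @[t --> (0 : R)] --> expR (s * 0) * a.
    apply: cvgM; last exact: cvg_cst.
    apply: continuous_cvg; first exact: continuous_expR.
    by apply: cvgM; [exact: cvg_cst|exact: cvg_id].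
  by rewrite mulr0 expR0 mul1r.
have [e /= e0 aeV] := aV.
have /cvgrPdist_lt/(_ _ e0) lower := cvg_at_right_filter (cont (-1)).
have /cvgrPdist_lt/(_ _ e0) upper := cvg_at_right_filter (cont 1).
near (0 : R)^'+ => eta.
have eta0 : 0 < eta by near: eta; exact: nbhs_right_gt.
have lo : `|a - expR (-1 * eta) * a| < e by near: eta; exact: lower.
have up : `|a - expR (1 * eta) * a| < e by near: eta; exact: upper.
exists eta => // b; case: b => [b| |].
- rewrite -!EFinM !lee_fin => ab ba; apply: aeV => /=.
  move: lo up; rewrite mulN1r mul1r !ltr_norml.
  have : expR (- eta) * a <= b by rewrite expRN ler_pdivrMl ?expR_gt0.
  lra.
- by rewrite leye_eq.
- by rewrite gt0_muleNy ?lte_fin ?expR_gt0.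
Unshelve. all: by end_near. Qed.

Theorem corollary2p12 (R : realType) (A : pmetricType R)
    (hA : pwcpd_space A) (V : set (\bar R)) (hV : nbhs (magnitude A) V) :
  exists delta : R, 0 < delta /\
    forall B : pmetricType R, pwcpd_space B ->
      (gh_dist A B < delta%:E)%E -> V (magnitude B).
Proof.
have [cA _ wA] := hA; rewrite wA in hV.
have [eta eta0 etaV] := nbhs_ereal_expR hV.
have d0 : 0 < eta / 4 by rewrite divr_gt0.
exists (eta / 4); split=> // B [cB _ ->] AB.
have [] := max_diversity_le_gh cA cB d0 AB.
by rewrite mulrC divfK//; exact: etaV.
Qed.
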